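(* Let $q\in\mathbb{C}$ with $q\neq1$ be such that $[n]_q\neq 0$ for all $n\geq 1$, let $u,\alpha\in\mathbb{C}$, let $(a_n^{(\alpha)})_{n\ge0}$ be complex numbers with $a_0^{(\alpha)}\neq0$, $(\mathcal{A}_q(t))^{\alpha}=\sum_{n\ge0}a_n^{(\alpha)}\frac{t^n}{[n]_q!}$, and define $\mathrm{P}_{n,q}^{(\alpha)}(x,y;u)$ by $(\mathcal{A}_q(t))^{\alpha}\mathrm{e}_q(tx)\mathrm{e}_q(ty,u)=\sum_{n\ge0}\mathrm{P}_{n,q}^{(\alpha)}(x,y;u)\frac{t^n}{[n]_q!}$. Then for all $n\ge1$, $$D_{q,x}\mathrm{P}_{n,q}^{(\alpha)}(x,y;u)=[n]_q\mathrm{P}_{n-1,q}^{(\alpha)}(x,y;u),\qquad D_{q,y}\mathrm{P}_{n,q}^{(\alpha)}(x,y;u)=[n]_q\mathrm{P}_{n-1,q}^{(\alpha)}(x,uy;u).$$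
   Context: $[n]_q=\frac{1-q^n}{1-q}$, $[n]_q!=[1]_q\cdots[n]_q$ ($[0]_q!=1$). $\mathrm{e}_q(z,u)=\sum_{n\ge0}u^{\binom{n}{2}}\frac{z^n}{[n]_q!}$ (convention $0^0=1$), $\mathrm{e}_q(z)=\mathrm{e}_q(z,1)$. The $q$-derivative is $D_qf(x)=\frac{f(x)-f(qx)}{(1-q)x}$; $D_{q,x}$, $D_{q,y}$ denote the $q$-derivative with respect to $x$, resp. $y$. *)

(* Defs.v *)
From HB Require Import structures.
From mathcomp Require Import all_boot all_order all_algebra.
From mathcomp Require Export complex.
From mathcomp Require Export all_classical all_reals all_analysis.
Export numFieldNormedType.Exports.

Set Implicit Arguments.
Unset Strict Implicit.
Unset Printing Implicit Defensive.

Import Order.TTheory GRing.Theory Num.Theory.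
Local Open Scope ring_scope.
Local Open Scope classical_set_scope.

Section QCalculus.
Variable K : numFieldType.
Implicit Types q u c x : K.

Definition qnum q (n : nat) : K := (1 - q ^+ n) / (1 - q).

Definition qfact q (n : nat) : K := \prod_(1 <= i < n.+1) qnum q i.

(* The formula (f x - f (q x)) / ((1 - q) x) is extended to x = 0 by
   continuity; for a function f differentiable at 0 (and q != 1) the value
   there is f'(0). *)
Definition qderiv q (f : K -> K) (x : K) : K :=
  let quot z := (f z - f (q * z)) / ((1 - q) * z) in
  if x == 0 then lim (quot z @[z --> (0 : K)^']) else quot x.

(* A formal power series in one variable t is the sequence of its
   coefficients; [fps_mul] is the Cauchy product and [fps_dilate c F] is the
   series F(c t). *)
Definition fps := nat -> K.

Definition fps_mul (F G : fps) : fps :=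
  fun n => \sum_(i < n.+1) F i * G (n - i)%N.

Definition fps_dilate c (F : fps) : fps := fun n => c ^+ n * F n.

(* The series \sum_n a_n t^n / [n]_q!. *)
Definition qegf q (a : nat -> K) : fps := fun n => a n / qfact q n.

Definition qexp q u : fps := qegf q (fun n => u ^+ 'C(n, 2)).

End QCalculus.

(* Main.v *)
(** The series [E(t) = e_q(t, u)] satisfies the functional equation
    [E(tx) - E(tqx) = (1 - q) tx E(tux)], which survives multiplication by
    series not depending on [x].  Comparing coefficients of the generating
    function yields [P_n(x) - P_n(qx) = (1 - q) x [n]_q P_(n-1)(ux)], which is
    the claim for [x != 0]; at [x = 0] it follows by continuity.  The
    [x]-derivative is the case [u = 1]. *)
Require Import Defs.
From mathcomp Require Import all_boot all_order all_algebra.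
From mathcomp Require Import complex all_classical all_reals all_analysis.
From mathcomp Require Import ring.

Import GRing.Theory.
Local Open Scope ring_scope.
Local Open Scope classical_set_scope.

(** Dividing the functional equation by [(1 - q) * z] settles every nonzero point; continuity of [g]
    is needed only for the value at [0], which is a limit. *)
Lemma qderivE {K : numFieldType} (q : K) (f g : K -> K) :
  q != 1 -> continuous g ->
  (forall z, f z - f (q * z) = (1 - q) * z * g z) ->
  forall x, qderiv q f x = g x.
Proof.
move=> q1 cg fg x.
have quotE z : z != 0 -> (f z - f (q * z)) / ((1 - q) * z) = g z.
  by move=> z0; rewrite fg mulrC mulKf// mulf_neq0// subr_eq0 eq_sym.
rewrite /qderiv; case: eqVneq => [->|/quotE//].
(* On a punctured neighbourhood of [0] the quotient coincides with [g], so it has the same limit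
   [g 0]. *)
apply: cvg_lim => //; apply: (@cvg_trans _ (g z @[z --> (0 : K)^'])).
  by apply: near_eq_cvg; near do rewrite quotE//; exact: nbhs_dnbhs_neq.
exact/continuous_withinNx/cg.
Unshelve. all: by end_near. Qed.

Section FormalPowerSeries.
Context {K : numFieldType}.
Implicit Types F G H : fps K.

(* The coefficientwise form of [F t - F' t = c t G t]. *)
Definition fps_diff_eq (c : K) (F F' G : fps K) :=
  F 0%N = F' 0%N /\ forall n, F n.+1 - F' n.+1 = c * G n.

Lemma fps_diff_eq_mull c F F' G H :
  fps_diff_eq c F F' G -> fps_diff_eq c (fps_mul H F) (fps_mul H F') (fps_mul H G).
Proof.
move=> [F0 FS]; split=> [|n]; first by rewrite /fps_mul !big_ord1 F0.
(* The last term of the convolution carries [F 0 - F' 0 = 0]; in all others the index [n.+1 - i] is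
   a successor, so the recurrence applies. *)
rewrite /fps_mul -sumrB big_ord_recr /= subnn F0 subrr addr0 mulr_sumr.
apply: eq_bigr => -[i /=]; rewrite ltnS => le_in _.
by rewrite -mulrBr subSn// FS mulrCA.
Qed.

Lemma fps_diff_eq_mulr c F F' G H :
  fps_diff_eq c F F' G -> fps_diff_eq c (fps_mul F H) (fps_mul F' H) (fps_mul G H).
Proof.
move=> [F0 FS]; split=> [|n]; first by rewrite /fps_mul !big_ord1 F0.
rewrite /fps_mul -sumrB big_ord_recl /= F0 subrr add0r mulr_sumr.
by apply: eq_bigr => i _; rewrite -mulrBl FS subSS mulrA.
Qed.

Lemma qfactS (q : K) n : qfact q n.+1 = qfact q n * qnum q n.+1.
Proof. by rewrite /qfact big_nat_recr. Qed.

Lemma qfact_neq0 (q : K) n :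
  (forall k, (1 <= k)%N -> qnum q k != 0) -> qfact q n != 0.
Proof.
move=> q0; elim: n => [|n IHn]; first by rewrite /qfact big_nil oner_neq0.
by rewrite qfactS mulf_neq0// q0.
Qed.

(** Since ['C(n.+1, 2) = 'C(n, 2) + n], the surplus factor [u ^+ n] turns the dilation by [x] into
    one by [u * x], while [1 - q ^+ n.+1] cancels against [qnum q n.+1] and leaves [1 - q]. *)
Lemma qexp_dilate_diff (q u x : K) :
  q != 1 -> (forall k, (1 <= k)%N -> qnum q k != 0) ->
  fps_diff_eq ((1 - q) * x) (fps_dilate x (qexp q u))
    (fps_dilate (q * x) (qexp q u)) (fps_dilate (u * x) (qexp q u)).
Proof.
move=> q1 q0; split=> [|n]; first by rewrite /fps_dilate !expr0.
rewrite /fps_dilate /qexp /qegf qfactS binS bin1 exprD !exprMn.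
have := qfact_neq0 q n q0; have := q0 n.+1 isT; rewrite /qnum => qn0 qf0.
have q1' : 1 - q != 0 by rewrite subr_eq0 eq_sym.
have qn1 : 1 - q ^+ n.+1 != 0 by apply: contraNneq qn0 => ->; rewrite mul0r.
move: qn1; rewrite !exprS => qn1.
by field; rewrite qf0 q1' qn1.
Qed.

Lemma continuous_mulr {T : topologicalType} (f g : T -> K) :
  continuous f -> continuous g -> continuous (fun x => f x * g x).
Proof. by move=> cf cg x; exact: (@continuousM _ _ f g x (cf x) (cg x)). Qed.

Lemma continuous_fps_dilate F n : continuous (fun x => fps_dilate x F n).
Proof.
apply: continuous_mulr => [|x]; last exact: cst_continuous.
elim: n => [x|n IHn]; first exact: cst_continuous.
under eq_fun do rewrite exprS.
by apply: continuous_mulr => // x; exact: cvg_id.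
Qed.

Lemma continuous_fps_mul {T : topologicalType} (F G : T -> fps K) n :
  (forall k, continuous (fun x => F x k)) ->
  (forall k, continuous (fun x => G x k)) ->
  continuous (fun x => fps_mul (F x) (G x) n).
Proof.
move=> cF cG; apply: continuous_big => [|i _]; first exact: add_continuous.
exact: continuous_mulr.
Qed.

End FormalPowerSeries.

(** Here [S x] is the whole generating function with one variable singled out, so that both partial
    derivatives are instances. *)
Lemma qderiv_qegf_coef {K : numFieldType} (q u : K) (S : K -> fps K)
    (p : K -> nat -> K) :
  q != 1 -> (forall k, (1 <= k)%N -> qnum q k != 0) ->
  (forall x, fps_diff_eq ((1 - q) * x) (S x) (S (q * x)) (S (u * x))) ->
  (forall n, continuous (fun x => S x n)) ->
  (forall x, S x =1 qegf q (p x)) ->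
  forall n x, qderiv q (fun x' => p x' n.+1) x = qnum q n.+1 * p (u * x) n.
Proof.
move=> q1 q0 dS cS Sp n x.
(* Clearing the factorial transfers both continuity and the functional equation from [S] to [p]. *)
have pE y m : p y m = qfact q m * S y m.
  by rewrite Sp /qegf mulrC divfK// qfact_neq0.
apply: (@qderivE _ q _ (fun y => qnum q n.+1 * p (u * y) n)) => // [|z].
  under eq_fun do rewrite pE.
  do 2 (apply: continuous_mulr => [y|]; first exact: cst_continuous).
  move=> y; apply: (@continuous_comp _ _ _ ( *%R u) (fun z => S z n)).
    exact: mulrl_continuous.
  exact: cS.
by rewrite !pE -mulrBr (dS z).2 qfactS; ring.
Qed.

Lemma qderiv_two_variable {K : numFieldType} (q u : K) (a : nat -> K)
    (p : nat -> K -> K -> K) :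
  q != 1 -> (forall n, (1 <= n)%N -> qnum q n != 0) ->
  (forall x y,
     fps_mul (fps_mul (qegf q a) (fps_dilate x (qexp q 1)))
             (fps_dilate y (qexp q u))
     =1 qegf q (fun n => p n x y)) ->
  forall n x y,
    qderiv q (fun x' => p n.+1 x' y) x = qnum q n.+1 * p n x y
    /\ qderiv q (fun y' => p n.+1 x y') y = qnum q n.+1 * p n x (u * y).
Proof.
move=> q1 q0 hp n x y.
have cst (F : fps K) k : continuous (fun _ : K => F k).
  by move=> z; exact: cst_continuous.
split.
(* With [u = 1] the dilation [u * x] is [1 * x], which has to appear literally. *)
- rewrite -[in RHS](mul1r x).
  pose S z := fps_mul (fps_mul (qegf q a) (fps_dilate z (qexp q 1)))
                      (fps_dilate y (qexp q u)).
  apply: (@qderiv_qegf_coef _ q 1 S (fun z m => p m z y)) => // [z|m|z]; last exact: hp.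
    (* The factor depending on [z] is the middle one, hence a multiplication on each side. *)
    exact/fps_diff_eq_mulr/fps_diff_eq_mull/qexp_dilate_diff.
  apply: continuous_fps_mul => [k|//]; apply: continuous_fps_mul => // j.
  exact: continuous_fps_dilate.
- pose S z := fps_mul (fps_mul (qegf q a) (fps_dilate x (qexp q 1)))
                      (fps_dilate z (qexp q u)).
  apply: (@qderiv_qegf_coef _ q u S (fun z m => p m x z)) => // [z|m|z]; last exact: hp.
    exact/fps_diff_eq_mull/qexp_dilate_diff.
  by apply: continuous_fps_mul => // j; exact: continuous_fps_dilate.
Qed.

Theorem theorem6 (R : realType) (q u alpha : R[i])
    (a : R[i] -> nat -> R[i])
    (P : R[i] -> nat -> R[i] -> R[i] -> R[i] -> R[i])
    (hq1 : q != 1)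
    (hq : forall n : nat, (1 <= n)%N -> qnum q n != 0)
    (ha0 : a alpha 0%N != 0)
    (hP : forall x y : R[i],
       fps_mul (fps_mul (qegf q (a alpha)) (fps_dilate x (qexp q 1)))
               (fps_dilate y (qexp q u))
       =1 qegf q (fun n => P alpha n x y u)) :
  forall n : nat, (1 <= n)%N -> forall x y : R[i],
    qderiv q (fun x' => P alpha n x' y u) x
      = qnum q n * P alpha n.-1 x y u
    /\ qderiv q (fun y' => P alpha n x y' u) y
      = qnum q n * P alpha n.-1 x (u * y) u.
Proof.
case=> [//|n] _ x y.
exact: (@qderiv_two_variable _ q u (a alpha) (fun n x y => P alpha n x y u)).
Qed.
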